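(* Let $c_1,\dots,c_k\in\mathbb{R}^d$ ($k\ge2$) be distinct fixed centers and let $X,X'\in(\mathbb{R}^d)^n$ satisfy $\|X-X'\|\le\varepsilon$. Let $i\in[n]$. If $x_i$ changes its assigned center under the perturbation, i.e. $\ell(x_i')\ne\ell(x_i)$, then $\gamma_i\le2\varepsilon$.
   Context: Here $n\ge 2$, $[n]=\{1,\dots,n\}$, and $\|\cdot\|$ on $\mathbb{R}^d$ is the Euclidean norm. Configurations are ordered tuples $X=(x_1,\dots,x_n)$, $X'=(x_1',\dots,x_n')$ in $(\mathbb{R}^d)^n$, and $\|X-X'\|=\max_{1\le i\le n}\|x_i-x_i'\|$. Nearest-center assignment with a deterministic tie-breaking rule: a fixed function $\ell:\mathbb{R}^d\to\{1,\dots,k\}$ with $\|x-c_{\ell(x)}\|\le\|x-c_j\|$ for all $x\in\mathbb{R}^d$ and all $j$; the point $x$ is assigned to the center $c_{\ell(x)}$. The same centers and the same $\ell$ are used for $X$ and $X'$. Write $\ell_i=\ell(x_i)$. The margin of $x_i$ is $\gamma_i=\min_{j\ne\ell_i}\bigl(\|x_i-c_j\|-\|x_i-c_{\ell_i}\|\bigr)$. *)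

(* Defs.v *)
From mathcomp Require Import all_boot all_order all_algebra.
From mathcomp Require Import reals.

Set Implicit Arguments.
Unset Strict Implicit.
Unset Printing Implicit Defensive.

Import Order.TTheory GRing.Theory Num.Theory.
Local Open Scope ring_scope.

(* The library's norm on matrices is the sup norm, so the Euclidean norm has
   to be introduced separately. *)
Definition enorm (R : realType) (d : nat) (x : 'rV[R]_d) : R :=
  Num.sqrt (\sum_(a < d) x ord0 a ^+ 2).

(* Starting the maximum at 0 is harmless: all the terms are nonnegative. *)
Definition config_dist (R : realType) (d n : nat) (X X' : 'I_n -> 'rV[R]_d) : R :=
  \big[Num.max/0]_(i < n) enorm (X i - X' i).

Definition nearest_center (R : realType) (d k : nat) (c : 'I_k -> 'rV[R]_d)
    (ell : 'rV[R]_d -> 'I_k) : Prop :=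
  forall (x : 'rV[R]_d) (j : 'I_k), enorm (x - c (ell x)) <= enorm (x - c j).

(* Least element of a nonempty sequence, with junk value 0 on [::].  The
   iteration starts at the first entry, so no foreign value enters the minimum. *)
Definition seq_min (R : realType) (s : seq R) : R :=
  \big[Num.min/head 0 s]_(v <- s) v.

(* The sequence is nonempty as soon as k >= 2; see marginP. *)
Definition margin (R : realType) (d k : nat) (c : 'I_k -> 'rV[R]_d)
    (ell : 'rV[R]_d -> 'I_k) (x : 'rV[R]_d) : R :=
  seq_min [seq enorm (x - c j) - enorm (x - c (ell x))
          | j <- enum 'I_k & j != ell x].

Lemma seq_min_le (R : realType) (s : seq R) (v : R) : v \in s -> seq_min s <= v.
Proof. by move=> vs; rewrite /seq_min; exact: ge_bigmin_seq. Qed.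

Lemma seq_min_in (R : realType) (s : seq R) : s != [::] -> seq_min s \in s.
Proof.
case: s => // a s _; rewrite /seq_min big_seq /=.
elim/big_ind: _ => [|u v us vs|//]; first exact: mem_head.
by rewrite minEle; case: ifP.
Qed.

Lemma marginP (R : realType) (d k : nat) (c : 'I_k -> 'rV[R]_d)
    (ell : 'rV[R]_d -> 'I_k) (x : 'rV[R]_d) : (2 <= k)%N ->
  (exists2 j, j != ell x &
     margin c ell x = enorm (x - c j) - enorm (x - c (ell x))) /\
  (forall j, j != ell x ->
     margin c ell x <= enorm (x - c j) - enorm (x - c (ell x))).
Proof.
move=> k2; have lb j : j != ell x ->
    enorm (x - c j) - enorm (x - c (ell x)) \in
    [seq enorm (x - c j) - enorm (x - c (ell x)) | j <- enum 'I_k & j != ell x].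
  by move=> jl; apply/mapP; exists j => //; rewrite mem_filter jl mem_enum.
split; last by move=> j /lb; exact: seq_min_le.
have [j jl] : exists j, j != ell x.
  apply/existsP; rewrite -negb_forall; apply/negP => /forallP H.
  have := cardC1 (ell x); rewrite card_ord.
  by rewrite eq_card0 => [|j]; [case: k k2 {c ell lb H} (x) => [|[]] | rewrite inE (eqP (H j)) eqxx].
have /seq_min_in/mapP[i] : [seq enorm (x - c j) - enorm (x - c (ell x))
    | j <- enum 'I_k & j != ell x] != [::] by apply/eqP => e; have := lb j jl; rewrite e.
by rewrite mem_filter => /andP[il _] e; exists i.
Qed.

(* Main.v *)
Require Import Defs.
From mathcomp Require Import all_boot all_order all_algebra.
From mathcomp Require Import reals ring lra.

Set Implicit Arguments.
Unset Strict Implicit.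
Unset Printing Implicit Defensive.

Import Order.TTheory GRing.Theory Num.Theory.
Local Open Scope ring_scope.

(** Moving a point by at most [eps] changes its distance to any center by at
    most [eps].  Let [j] be the center assigned to the perturbed point [x'] and
    [l] the one assigned to [x].  Then
    [|x - c_j| <= |x' - c_j| + eps <= |x' - c_l| + eps <= |x - c_l| + 2 eps],
    where the middle step says that [j] is nearest to [x'].  As [j] differs from
    [l], it competes in the minimum defining the margin of [x]
    ([margin_le_double_dist]).  The analytic input is the triangle inequality for
    the Euclidean norm ([enormD]), which rests on Cauchy-Schwarz. *)

(** Lagrange's identity: the difference of the two sides is half the sum over
    all pairs [(a, b)] of the squares [(x a * y b - x b * y a) ^+ 2]. *)
Lemma cauchy_schwarz_sum (R : realFieldType) (I : finType) (x y : I -> R) :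
  (\sum_a x a * y a) ^+ 2 <= (\sum_a x a ^+ 2) * (\sum_a y a ^+ 2).
Proof.
have lagrange : \sum_a \sum_b (x a * y b - x b * y a) ^+ 2 =
    2 * ((\sum_a x a ^+ 2) * (\sum_a y a ^+ 2) - (\sum_a x a * y a) ^+ 2).
  transitivity (\sum_a \sum_b (x a ^+ 2 * y b ^+ 2 + y a ^+ 2 * x b ^+ 2
                               - 2 * ((x a * y a) * (x b * y b)))).
    by apply: eq_bigr => a _; apply: eq_bigr => b _; ring.
  under eq_bigr do rewrite sumrB big_split /= -!mulr_sumr.
  by rewrite sumrB big_split /= -mulr_sumr -!mulr_suml; ring.
have : 0 <= \sum_a \sum_b (x a * y b - x b * y a) ^+ 2.
  by apply: sumr_ge0 => a _; apply: sumr_ge0 => b _; exact: sqr_ge0.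
by rewrite lagrange pmulr_rge0 ?ltr0n // subr_ge0.
Qed.

Lemma enorm_ge0 (R : realType) (d : nat) (x : 'rV[R]_d) : 0 <= enorm x.
Proof. exact: sqrtr_ge0. Qed.

Lemma sqr_enorm (R : realType) (d : nat) (x : 'rV[R]_d) :
  enorm x ^+ 2 = \sum_(a < d) x ord0 a ^+ 2.
Proof. by rewrite sqr_sqrtr // sumr_ge0 // => a _; exact: sqr_ge0. Qed.

Lemma enormN (R : realType) (d : nat) (x : 'rV[R]_d) : enorm (- x) = enorm x.
Proof.
by congr Num.sqrt; apply: eq_bigr => a _; rewrite mxE sqrrN.
Qed.

(** Squaring both sides reduces this to Cauchy-Schwarz for the cross term. *)
Lemma enormD (R : realType) (d : nat) (x y : 'rV[R]_d) :
  enorm (x + y) <= enorm x + enorm y.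
Proof.
rewrite -ler_sqr ?nnegrE ?addr_ge0 ?enorm_ge0 // sqrrD !sqr_enorm.
have -> : \sum_(a < d) (x + y) ord0 a ^+ 2 = \sum_(a < d) x ord0 a ^+ 2
    + (\sum_(a < d) x ord0 a * y ord0 a) *+ 2 + \sum_(a < d) y ord0 a ^+ 2.
  rewrite -sumrMnl -!big_split; apply: eq_bigr => a _.
  by rewrite mxE sqrrD.
rewrite lerD2r lerD2l lerMn2r /=.
apply: le_trans (ler_norm _) _.
rewrite -ler_sqr ?nnegrE ?mulr_ge0 ?enorm_ge0 // real_normK ?num_real //.
by rewrite exprMn !sqr_enorm cauchy_schwarz_sum.
Qed.

Lemma enorm_le_config_dist (R : realType) (d n : nat) (X X' : 'I_n -> 'rV[R]_d)
    (i : 'I_n) : enorm (X i - X' i) <= config_dist X X'.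
Proof. exact: (le_bigmax _ (fun i => enorm (X i - X' i))). Qed.

(** The center newly assigned to [x'] beats the old one at [x'], so at [x] it
    can lose by at most twice the displacement. *)
Lemma margin_le_double_dist (R : realType) (d k : nat) (c : 'I_k -> 'rV[R]_d)
    (ell : 'rV[R]_d -> 'I_k) (x x' : 'rV[R]_d) :
  (2 <= k)%N -> nearest_center c ell -> ell x' != ell x ->
  margin c ell x <= 2 * enorm (x - x').
Proof.
move=> k2 near neq.
have [_ /(_ _ neq) le_margin] := marginP c ell x k2.
apply: le_trans le_margin _.
have new_center := enormD (x - x') (x' - c (ell x')).
have old_center := enormD (x' - x) (x - c (ell x)).
rewrite !subrKA in new_center old_center.
rewrite -[x' - x]opprB enormN in old_center.
have := near x' (ell x); lra.
Qed.

Theorem proposition5p4 (R : realType) (d n k : nat) (hn : (2 <= n)%N)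
    (hk : (2 <= k)%N) (c : 'I_k -> 'rV[R]_d) (hc : injective c)
    (ell : 'rV[R]_d -> 'I_k) (hell : nearest_center c ell)
    (X X' : 'I_n -> 'rV[R]_d) (eps : R) (hX : config_dist X X' <= eps)
    (i : 'I_n) (hi : ell (X' i) <> ell (X i)) :
  margin c ell (X i) <= 2 * eps.
Proof.
move/eqP: hi => /(margin_le_double_dist hk hell) le_margin.
apply: le_trans le_margin _; rewrite ler_pM2l ?ltr0n //.
exact: le_trans (enorm_le_config_dist X X' i) hX.
Qed.
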